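(* Let $d\ge 2$ be an integer. Up to equivalence, the DRS splittings are the only frugal, unconditionally convergent resolvent-splittings without lifting for the problem class (2op-$\mathbb{R}^d$). That is, a pair $(T,S)$ of functions $T,S:\mathcal{M}(\mathbb{R}^d)\times\mathcal{M}(\mathbb{R}^d)\times\mathbb{R}^d\to\mathbb{R}^d$ is a frugal, unconditionally convergent resolvent-splitting without lifting for (2op-$\mathbb{R}^d$) if and only if it is equivalent to a DRS splitting, i.e., to a pair $(\hat T,\hat S)$ for which there exist $\alpha>0$, $\theta\in(0,2)$ and $\eta\in\mathbb{R}$ such that for all $A,B\in\mathcal{M}(\mathbb{R}^d)$ and $z\in\mathbb{R}^d$, $$\hat T(A,B,z)=(1-\theta/2)z+(\theta/2)(2J_{\alpha B}-I)(2J_{\alpha A}-I)z,$$ $$\hat S(A,B,z)=\eta J_{\alpha A}z+(1-\eta)J_{\alpha B}(2J_{\alpha A}-I)z .$$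
   Context: $\mathcal{M}(\mathbb{R}^d)$ is the set of all maximal monotone (set-valued) operators on $\mathbb{R}^d$ (with the Euclidean inner product). For $A\in\mathcal{M}(\mathbb{R}^d)$ and $\alpha>0$, $J_{\alpha A}=(I+\alpha A)^{-1}:\mathbb{R}^d\to\mathbb{R}^d$ is the resolvent. For an operator $C$ on $\mathbb{R}^d$, $\operatorname{zer} C=\{x\in\mathbb{R}^d: 0\in Cx\}$. Problem class (2op-$\mathbb{R}^d$): all problems of finding $x\in\mathbb{R}^d$ with $0\in(A+B)x$, where $A,B\in\mathcal{M}(\mathbb{R}^d)$. Fixed-point encoding: a pair $(T,S)$ with $T,S:\mathcal{M}(\mathbb{R}^d)\times\mathcal{M}(\mathbb{R}^d)\times\mathbb{R}^d\to\mathbb{R}^d$ is a fixed-point encoding for (2op-$\mathbb{R}^d$) if for all $A,B\in\mathcal{M}(\mathbb{R}^d)$ and all $x^\star\in\mathbb{R}^d$: there exists $z^\star\in\mathbb{R}^d$ with $T(A,B,z^\star)=z^\star$ and $S(A,B,z^\star)=x^\star$ if and only if $0\in(A+B)(x^\star)$. The class $\mathcal{F}$: consider maps $\mathcal{M}(\mathbb{R}^d)\times\mathcal{M}(\mathbb{R}^d)\times\mathbb{R}^d\to\mathbb{R}^d$. Let $I(A,B,z)=z$, $J_{\alpha,1}(A,B,z)=J_{\alpha A}(z)$, $J_{\beta,2}(A,B,z)=J_{\beta B}(z)$. Composition is $(F\circ G)(A,B,z)=F(A,B,G(A,B,z))$. Let $\mathcal{F}_0=\{I\}\cup\{J_{\alpha,1}:\alpha>0\}\cup\{J_{\beta,2}:\beta>0\}$,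 and recursively $\mathcal{F}_{i+1}=\{F+G: F,G\in\mathcal{F}_i\}\cup\{F\circ G:F,G\in\mathcal{F}_i\}\cup\{\gamma F:F\in\mathcal{F}_i,\gamma\in\mathbb{R}\}$, and $\mathcal{F}=\bigcup_{i\ge0}\mathcal{F}_i$. $(T,S)$ is a resolvent-splitting without lifting for (2op-$\mathbb{R}^d$) if it is a fixed-point encoding for (2op-$\mathbb{R}^d$) and $T,S\in\mathcal{F}$. Such $(T,S)$ is frugal if, for some fixed $\alpha,\beta>0$, there is a finite step-by-step (serial) evaluation procedure (the same for all $A,B,z$) which starts from the input $z$, where each step is a scalar multiplication (by a fixed real), a vector addition, or a resolvent evaluation applied to previously available vectors, exactly one step evaluates $J_{\alpha A}$, exactly one step evaluates $J_{\beta B}$, and both $T(A,B,z)$ and $S(A,B,z)$ are output at the end. Unconditional convergence: $(T,S)$ converges unconditionally for (2op-$\mathbb{R}^d$) if for all $A,B\in\mathcal{M}(\mathbb{R}^d)$ with $\operatorname{zer}(A+B)\neq\emptyset$ and every $z^0\in\mathbb{R}^d$, the sequence of iterates $z^{k+1}=T(A,B,z^k)$ converges, as $k\to\infty$, to some $z^\star\in\mathbb{R}^d$ with $S(A,B,z^\star)\in\operatorname{zer}(A+B)$. Equivalence: two resolvent-splittings without lifting are equivalent if one can be obtained from the other through scaling with a nonzero scalar and/or swapping the roles of $A$ and $B$. Scaling by $a\ne0$ replaces $(T,S)$ by the pair $(A,B,z)\mapsto aT(A,B,a^{-1}z)$, $(A,B,z)\mapsto S(A,B,a^{-1}z)$.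 Swapping replaces $(T,S)$ by the pair $(A,B,z)\mapsto T(B,A,z)$, $(A,B,z)\mapsto S(B,A,z)$. *)

(* Defs.v *)
From HB Require Import structures.
From mathcomp Require Import all_boot all_order all_algebra.
From mathcomp Require Import all_classical all_reals all_analysis.

Set Implicit Arguments.
Unset Strict Implicit.
Unset Printing Implicit Defensive.

Import Order.TTheory GRing.Theory Num.Theory.
Import numFieldNormedType.Exports.
Local Open Scope classical_set_scope.
Local Open Scope ring_scope.

Section Operators.
Context (R : realType) (d : nat).
Notation V := 'rV[R]_d.

Definition dot (u v : V) : R := \sum_(i < d) u 0 i * v 0 i.

(* A set-valued operator is identified with its graph: A x u means u \in A x. *)
Definition setop := V -> set V.

Definition id_op : setop := fun x => [set x].

Definition add_op (A B : setop) : setop :=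
  fun x => [set w | exists u v, A x u /\ B x v /\ w = u + v].

Definition scale_op (a : R) (A : setop) : setop :=
  fun x => [set w | exists2 u, A x u & w = a *: u].

Definition inv_op (A : setop) : setop := fun u => [set x | A x u].

Definition zer (C : setop) : set V := [set x | C x 0].

Definition monotone_op (A : setop) : Prop :=
  forall x y u v, A x u -> A y v -> 0 <= dot (x - y) (u - v).

Definition maximal_monotone (A : setop) : Prop :=
  monotone_op A /\
  forall B : setop, monotone_op B -> (forall x, A x `<=` B x) -> B = A.

Record maxmon : Type := MaxMon {
  maxmon_op :> setop;
  maxmonP : maximal_monotone maxmon_op }.

(* By Minty's theorem (I + alpha A)^-1 z is a singleton whenever A is maximal
   monotone and alpha > 0; [xget] extracts its element, and the default value 0
   is irrelevant in that case. *)
Definition resolvent (alpha : R) (A : setop) (z : V) : V :=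
  xget 0 (inv_op (add_op id_op (scale_op alpha A)) z).

Definition opmap := maxmon -> maxmon -> V -> V.

Definition map_id : opmap := fun A B z => z.
Definition map_J1 (alpha : R) : opmap := fun A B z => resolvent alpha A z.
Definition map_J2 (beta : R) : opmap := fun A B z => resolvent beta B z.
Definition map_add (F G : opmap) : opmap := fun A B z => F A B z + G A B z.
Definition map_comp (F G : opmap) : opmap := fun A B z => F A B (G A B z).
Definition map_scale (c : R) (F : opmap) : opmap := fun A B z => c *: F A B z.

Fixpoint Fclass_ (i : nat) : set opmap :=
  match i with
  | 0%N => [set F | F = map_id
                 \/ (exists2 alpha, 0 < alpha & F = map_J1 alpha)
                 \/ (exists2 beta, 0 < beta & F = map_J2 beta)]
  | j.+1 => [set H | (exists F G, Fclass_ j F /\ Fclass_ j G /\ H = map_add F G)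
                 \/ (exists F G, Fclass_ j F /\ Fclass_ j G /\ H = map_comp F G)
                 \/ (exists F c, Fclass_ j F /\ H = map_scale c F)]
  end.

Definition Fclass : set opmap := \bigcup_i Fclass_ i.

Definition fixed_point_encoding (T S : opmap) : Prop :=
  forall (A B : maxmon) (xs : V),
    (exists zs : V, T A B zs = zs /\ S A B zs = xs) <-> add_op A B xs 0.

Definition resolvent_splitting (T S : opmap) : Prop :=
  [/\ fixed_point_encoding T S, Fclass T & Fclass S].

(* Serial evaluation procedures. The vectors available at some stage are kept
   in a list h: entry 0 is the input z and entry k.+1 is the output of the k-th
   step (counting from 0). The nat arguments of a step are positions in h. *)
Inductive step : Type :=
  | StepScale of R & nat
  | StepAdd of nat & nat
  | StepJA of nat
  | StepJB of nat.

Definition is_JA (s : step) : bool := if s is StepJA _ then true else false.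
Definition is_JB (s : step) : bool := if s is StepJB _ then true else false.

Definition step_ok (n : nat) (s : step) : bool :=
  match s with
  | StepScale _ i => (i < n)%N
  | StepAdd i j => (i < n)%N && (j < n)%N
  | StepJA i => (i < n)%N
  | StepJB i => (i < n)%N
  end.

(* Every step refers only to available vectors, n of them existing at first. *)
Fixpoint procedure_ok (n : nat) (p : seq step) : bool :=
  if p is s :: p' then step_ok n s && procedure_ok n.+1 p' else true.

Definition eval_step (alpha beta : R) (A B : setop) (h : seq V) (s : step) : V :=
  match s with
  | StepScale c i => c *: nth 0 h i
  | StepAdd i j => nth 0 h i + nth 0 h j
  | StepJA i => resolvent alpha A (nth 0 h i)
  | StepJB i => resolvent beta B (nth 0 h i)
  end.

Definition run (alpha beta : R) (A B : setop) (p : seq step) (z : V) : seq V :=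
  foldl (fun h s => rcons h (eval_step alpha beta A B h s)) [:: z] p.

(* iT and iS are the positions of the two outputs. *)
Definition frugal (T S : opmap) : Prop :=
  exists alpha beta : R, 0 < alpha /\ 0 < beta /\
  exists (p : seq step) (iT iS : nat),
    [/\ procedure_ok 1 p, count is_JA p = 1%N, count is_JB p = 1%N,
        (iT < (size p).+1)%N && (iS < (size p).+1)%N &
        forall (A B : maxmon) (z : V),
          T A B z = nth 0 (run alpha beta A B p z) iT /\
          S A B z = nth 0 (run alpha beta A B p z) iS].

Definition converges_unconditionally (T S : opmap) : Prop :=
  forall A B : maxmon, zer (add_op A B) !=set0 ->
  forall z0 : V, exists zs : V,
    (fun k : nat => iter k (T A B) z0) @ \oo --> zs /\
    zer (add_op A B) (S A B zs).

Definition scale_pair (a : R) (P : opmap * opmap) : opmap * opmap :=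
  (fun A B z => a *: P.1 A B (a^-1 *: z), fun A B z => P.2 A B (a^-1 *: z)).

Definition swap_pair (P : opmap * opmap) : opmap * opmap :=
  (fun A B z => P.1 B A z, fun A B z => P.2 B A z).

(* Scaling and swapping commute and scaling by 1 is the identity, so these two
   cases exhaust all combinations of the two operations. *)
Definition equivalent (P Q : opmap * opmap) : Prop :=
  exists2 a : R, a != 0 & P = scale_pair a Q \/ P = scale_pair a (swap_pair Q).

Definition reflected (alpha : R) (A : setop) (z : V) : V :=
  2 *: resolvent alpha A z - z.

Definition DRS_splitting (T S : opmap) : Prop :=
  exists alpha theta eta : R, [/\ 0 < alpha, 0 < theta, theta < 2 &
    forall (A B : maxmon) (z : V),
      T A B z = (1 - theta / 2) *: z
                + (theta / 2) *: reflected alpha B (reflected alpha A z) /\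
      S A B z = eta *: resolvent alpha A z
                + (1 - eta) *: resolvent alpha B (reflected alpha A z)].

End Operators.

(* Main.v *)
Require Import Defs.
From mathcomp Require Import all_boot all_order all_algebra.
From mathcomp Require Import all_classical all_reals all_analysis.
From mathcomp Require Import ring lra zify.

Set Implicit Arguments.
Unset Strict Implicit.
Unset Printing Implicit Defensive.

Import Order.TTheory GRing.Theory Num.Theory.
Import numFieldNormedType.Exports.
Local Open Scope classical_set_scope.
Local Open Scope ring_scope.

(** Write J for resolvents. A frugal procedure evaluates only two resolvents
    and is linear otherwise, so, up to swapping the two operators,
    a = J_{alpha A} (c z), b = J_{beta B} (p z + q a), and T z, S z are fixed
    linear combinations of z, a and b ([frugal_two_step_form]).

    Given any vectors z, a, b there are operators that produce them: normal
    cones of points, whose resolvent is constant, and constant operators, whose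
    resolvent is a translation. Applied to triples on which the linear relation
    T z = z holds, the fixed-point encoding therefore forces this relation to
    be a = b, forces S z to be this common value, and forces the inclusions
    u in A a, v in B b read off the two resolvents to satisfy u + v = 0. This
    leaves T z = z + theta (b - a) with
    b = J_{beta B} ((1 + beta / alpha) a - (beta / alpha) c z)
    ([encoding_rigid]); c is nonzero since A = B = 0 makes every point a zero,
    and scaling by c reduces to c = 1.

    If A = 0 and B is the normal cone of the origin, then T = (1 - theta) I,
    whence 0 < theta < 2 ([relaxation_range]). If alpha and beta differ, suitable
    skew operators on a coordinate plane turn T into the multiplication by a
    complex number of modulus above 1 ([equal_stepsizes]); this is where d >= 2
    is used. With alpha = beta the map T is a Douglas-Rachford map.

    Conversely, resolvents of maximal monotone operators are defined everywhere
    by Minty's theorem ([resolventP]). The reflected resolvents are then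
    nonexpansive, and the Douglas-Rachford map averages the identity and a
    nonexpansive map with fixed points, so its iterates converge
    ([averaged_iterates_cvg]). All the properties involved are stable under
    scaling and swapping ([splitting_scale], [splitting_swap]). *)

(** * The Euclidean inner product *)

Section InnerProduct.
Context (R : realType) (d : nat).
Notation V := 'rV[R]_d.
Implicit Types (u v w : V) (a b : R).

Definition sqn u : R := dot u u.

Lemma dotC u v : dot u v = dot v u.
Proof. by apply: eq_bigr => i _; rewrite mulrC. Qed.

Lemma dotDl u v w : dot (u + v) w = dot u w + dot v w.
Proof. by rewrite -big_split; apply: eq_bigr => i _; rewrite !mxE mulrDl. Qed.

Lemma dotZl a u v : dot (a *: u) v = a * dot u v.
Proof. by rewrite big_distrr /=; apply: eq_bigr => i _; rewrite !mxE mulrA. Qed.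

Lemma dotNl u v : dot (- u) v = - dot u v.
Proof. by rewrite -scaleN1r dotZl mulN1r. Qed.

Lemma dotDr u v w : dot w (u + v) = dot w u + dot w v.
Proof. by rewrite dotC dotDl !(dotC w). Qed.

Lemma dotZr a u v : dot u (a *: v) = a * dot u v.
Proof. by rewrite dotC dotZl dotC. Qed.

Lemma dotNr u v : dot u (- v) = - dot u v.
Proof. by rewrite dotC dotNl dotC. Qed.

Lemma dot0l u : dot 0 u = 0.
Proof. by rewrite -(scale0r 0) dotZl mul0r. Qed.

Definition dotE := (dotDl, dotDr, dotZl, dotZr, dotNl, dotNr).

Lemma sqn_ge0 u : 0 <= sqn u.
Proof. by apply: sumr_ge0 => i _; rewrite -expr2 sqr_ge0. Qed.

Lemma sqnN u : sqn (- u) = sqn u.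
Proof. by rewrite /sqn !dotE opprK. Qed.

Lemma sqr_coord_le_sqn u i : u 0 i ^+ 2 <= sqn u.
Proof.
rewrite /sqn /dot (bigD1 i) //= -expr2 lerDl.
by apply: sumr_ge0 => j _; rewrite -expr2 sqr_ge0.
Qed.

Lemma sqn_eq0 u : sqn u <= 0 -> u = 0.
Proof.
move=> u0; apply/rowP => i; rewrite mxE; apply/eqP.
by rewrite -sqrf_eq0 eq_le sqr_ge0 andbT (le_trans (sqr_coord_le_sqn u i)).
Qed.

Lemma sqnD_le u v : sqn (u + v) <= 2 * (sqn u + sqn v).
Proof.
have := sqn_ge0 (u - v); rewrite /sqn !dotE (dotC v u).
by move=> ?; lra.
Qed.

Lemma dot_young u v a : 0 < a -> dot u v <= (a * sqn u + sqn v / a) / 2.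
Proof.
move=> a0; rewrite -(ler_pM2l a0).
have -> : a * ((a * sqn u + sqn v / a) / 2) = (a ^+ 2 * sqn u + sqn v) / 2.
  by field; rewrite gt_eqF.
have := sqn_ge0 (a *: u - v).
have -> : sqn (a *: u - v) = a ^+ 2 * sqn u - 2 * (a * dot u v) + sqn v.
  by rewrite /sqn !dotE (dotC v u); ring.
lra.
Qed.

(** The strong convexity of the squared norm, in exact form. *)
Lemma sqn_segment t u v :
  sqn ((1 - t) *: u + t *: v)
  = (1 - t) * sqn u + t * sqn v - t * (1 - t) * sqn (v - u).
Proof. by rewrite /sqn !dotE (dotC v u); ring. Qed.

End InnerProduct.

(** * Sequences of vectors and the squared norm *)

Section Sequences.
Context (R : realType) (d : nat).
Notation V := 'rV[R]_d.
Implicit Types (u v w : V) (z : nat -> V).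

Lemma sqn_lt_ball x y (e : R) :
  0 < e -> sqn (x - y) < e ^+ 2 -> ball (x : V) e y.
Proof.
move=> e0 xy; split=> // i j; rewrite (ord1 i) /ball /=.
have := le_lt_trans (sqr_coord_le_sqn (x - y) j) xy.
by rewrite !mxE -ltr_sqr ?nnegrE ?normr_ge0 ?ltW // real_normK ?num_real.
Qed.

Lemma ball_sqn_le x y (e : R) :
  0 < e -> ball (x : V) e y -> sqn (x - y) <= d%:R * e ^+ 2.
Proof.
move=> e0 [_ xy]; rewrite /sqn /dot.
have -> : d%:R * e ^+ 2 = \sum_(i < d) e ^+ 2.
  by rewrite sumr_const card_ord mulr_natl.
apply: ler_sum => i _; have := xy 0 i; rewrite /ball /= !mxE -expr2 => h.
rewrite -real_normK ?num_real // ler_sqr ?nnegrE ?normr_ge0 //; exact: ltW.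
Qed.

Lemma cvg_sqn z x :
  (forall e : R, 0 < e -> exists N, forall n, (N <= n)%N -> sqn (z n - x) < e) ->
  z n @[n --> \oo] --> x.
Proof.
move=> h; apply/cvg_ballP => e e0.
have [N hN] := h (e ^+ 2) ltac:(by rewrite exprn_gt0).
exists N => // n /= /hN zx; apply: sqn_lt_ball => //.
by rewrite -sqnN opprB.
Qed.

(** Bolzano-Weierstrass, in the form of a cluster point measured by the
    squared norm. *)
Lemma bounded_cluster z (M : R) : (forall n, sqn (z n) <= M) ->
  exists x, forall (e : R) N, 0 < e -> exists2 n, (N <= n)%N & sqn (z n - x) < e.
Proof.
move=> zM; pose K := [set v : V | forall i, v ord0 i \in `[- (M + 1), M + 1]].
have Kco : compact K.
  apply: (@rV_compact _ _ (fun=> `[(- (M + 1)), (M + 1)]%classic)).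
  by move=> _; apply: segment_compact.
have zK : (z n @[n --> \oo]) K.
  exists 0%N => // n _ /= i; rewrite in_itv /= -ler_norml.
  have M0 : 0 <= M by apply: le_trans (zM 0%N); exact: sqn_ge0.
  have := le_trans (sqr_coord_le_sqn (z n) i) (zM n).
  rewrite -real_normK ?num_real // => h.
  rewrite leNgt; apply/negP => h'; nra.
have [x [_ xcl]] := Kco _ _ zK; exists x => e N e0.
pose r := Num.sqrt (e / (d%:R + 1)).
have d0 : 0 < d%:R + 1 :> R by rewrite ltr_wpDl.
have ed : 0 < e / (d%:R + 1) by rewrite divr_gt0.
have r0 : 0 < r by rewrite sqrtr_gt0.
have [] := xcl (z @` [set n | (N <= n)%N]) (ball x r).
- by exists N => // n /= Nn; exists n.
- exact: nbhsx_ballx.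
move=> _ [[n Nn <-]] /ball_sqn_le -/(_ r0) h; exists n => //.
rewrite -sqnN opprB; apply: le_lt_trans h _.
rewrite sqr_sqrtr ?ltW // mulrCA -ltr_pdivlMl // mulVf ?gt_eqF //.
by rewrite ltr_pdivrMr // mul1r ltrDl.
Qed.

End Sequences.

(** * Resolvents and Minty's theorem *)

Section Resolvent.
Context (R : realType) (d : nat).
Notation V := 'rV[R]_d.
Implicit Types (A B : setop R d) (u v w x y z : V) (alpha : R).

Lemma resolventE alpha A x u :
  0 < alpha -> monotone_op A -> A x u -> resolvent alpha A (x + alpha *: u) = x.
Proof.
move=> a0 mA Axu; apply: xget_unique.
  by exists x, (alpha *: u); split; [|split; [exists u|]].
move=> y [_ [_ [-> [[v Ayv ->] e]]]]; apply/eqP; rewrite -subr_eq0; apply/eqP.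
have e1 : y - x = alpha *: (u - v).
  by rewrite -[y](addrK (alpha *: v)) -e scalerBr [LHS]addrC -addrA addKr.
have := mA _ _ _ _ Ayv Axu; rewrite -(opprB u v) dotNr oppr_ge0 => h.
apply: sqn_eq0; rewrite /sqn {2}e1 dotZr.
by rewrite mulr_ge0_le0 // ltW.
Qed.

(** Otherwise adding (x, u) to the graph would give a larger monotone one. *)
Lemma maximal_mem A x u : maximal_monotone A ->
  (forall y v, A y v -> 0 <= dot (x - y) (u - v)) -> A x u.
Proof.
case=> mA maxA rel.
pose B : setop R d := fun y v => A y v \/ y = x /\ v = u.
suff -> : A = B by right.
apply/esym/maxA; last by move=> y v; left.
move=> y1 y2 v1 v2 [Ay1|[-> ->]] [Ay2|[-> ->]].
- exact: mA.
- by rewrite -opprB dotNl -dotNr opprB; exact: rel.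
- exact: rel.
- by rewrite subrr dot0l.
Qed.

(** The easy half of Minty's theorem, which certifies that a concrete monotone
    operator is maximal. *)
Lemma surjective_maximal alpha A : 0 < alpha -> monotone_op A ->
  (forall z, exists x u, A x u /\ x + alpha *: u = z) -> maximal_monotone A.
Proof.
move=> a0 mA sA; split=> // B mB AB; apply/funext => y.
apply/seteqP; split; last exact: AB.
move=> v Byv; have [x [u [Axu e]]] := sA (y + alpha *: v).
have Bxu := AB _ _ Axu.
have xy : x = y.
  by rewrite -(resolventE a0 mB Bxu) e (resolventE a0 mB Byv).
move: e Axu; rewrite xy => /addrI /(scalerI _) -> //; by rewrite gt_eqF.
Qed.

End Resolvent.

Section Minty.
Context (R : realType) (d : nat).
Notation V := 'rV[R]_d.
Context (A : setop R d) (maxA : maximal_monotone A).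
Implicit Types (x u X U z w : V) (s t : R).

(** The epigraph of the Fitzpatrick function of [A]: a convex set that contains
    the points (x, u, <x,u>) of the graph. *)
Let fitz X U s := forall y v, A y v -> dot X v + dot y U <= s + dot y v.

Let fitz_graph x u : A x u -> fitz x u (dot x u).
Proof.
move=> Axu y v Ayv; have := maxA.1 _ _ _ _ Axu Ayv; rewrite !dotE => h.
by move: h; lra.
Qed.

Let fitz_convex t X U s X' U' s' : 0 <= t <= 1 -> fitz X U s -> fitz X' U' s' ->
  fitz ((1 - t) *: X + t *: X') ((1 - t) *: U + t *: U') ((1 - t) * s + t * s').
Proof.
move=> /andP[t0 t1] h h' y v Ayv; have := h _ _ Ayv; have := h' _ _ Ayv.
rewrite !dotE => k k'; have t1' : 0 <= 1 - t by lra.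
have := ler_wpM2l t0 k; have := ler_wpM2l t1' k'; lra.
Qed.

(** This is where maximality enters: a point below the duality product would be
    monotonically related to [A] without belonging to it. *)
Let fitz_ge_dot X U s : fitz X U s -> dot X U <= s.
Proof.
move=> h; rewrite leNgt; apply/negP => lt.
suff /h : A X U by lra.
apply: (maximal_mem maxA) => y v /h; rewrite !dotE; lra.
Qed.

(** For (X, U, s) = (z, -z, <z, -z>) the energy vanishes, its least possible
    value: solutions of -z in A z are minimisers. *)
Let energy X U s := sqn (X - U) / 4 + s.

Let energy_ge0 X U s : fitz X U s -> 0 <= energy X U s.
Proof.
move=> /fitz_ge_dot; have := sqn_ge0 (X + U).
by rewrite /energy /sqn !dotE (dotC U X); lra.
Qed.

Let energy_segment t X U s X' U' s' :
  energy ((1 - t) *: X + t *: X') ((1 - t) *: U + t *: U') ((1 - t) * s + t * s')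
  = (1 - t) * energy X U s + t * energy X' U' s'
    - t * (1 - t) * (sqn ((X' - U') - (X - U)) / 4).
Proof.
rewrite /energy.
have -> : (1 - t) *: X + t *: X' - ((1 - t) *: U + t *: U')
        = (1 - t) *: (X - U) + t *: (X' - U').
  by rewrite !scalerBr opprD addrACA.
by rewrite sqn_segment; field.
Qed.

Let energies := [set r | exists X U s, fitz X U s /\ r = energy X U s].

Let m := inf energies.

Let has_inf_energies : has_inf energies.
Proof.
split; last by exists 0 => _ [X [U [s [h ->]]]]; exact: energy_ge0.
have [x [u Axu]] : exists x u, A x u.
  apply: contrapT => N; apply: (N); exists 0, 0; apply: (maximal_mem maxA).
  by move=> y v Ayv; exfalso; apply: N; exists y, v.
by exists (energy x u (dot x u)), x, u, (dot x u); split=> //; exact: fitz_graph.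
Qed.

Let m_le X U s : fitz X U s -> m <= energy X U s.
Proof. by move=> h; apply: ge_inf; [case: has_inf_energies|exists X, U, s]. Qed.

(** First-order optimality of a near-minimiser along the segment towards a point
    of the graph: the derivative of the energy there is the gap below. *)
Let near_optimal e t X U s x u z : z = 2^-1 *: (X - U) -> 0 < t <= 1 -> A x u ->
  fitz X U s -> energy X U s <= m + e ->
  - (e / t) - t * (sqn ((x - u) - (X - U)) / 4) <= dot (x - z) (u + z).
Proof.
move=> zE /andP[t0 t1] Axu h he; set q := _ / 4.
have := m_le (fitz_convex (t := t) _ h (fitz_graph Axu)).
rewrite (ltW t0) t1 => /(_ isT); rewrite energy_segment -/q => mt.
have E0 := energy_ge0 h.
have gap : energy x u (dot x u) - q = dot (x - z) (u + z).
  by rewrite /energy /q zE /sqn !dotE !(dotC u) !(dotC U) !(dotC X); field.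
rewrite -gap -(ler_pM2l t0).
have -> : t * (- (e / t) - t * q) = - e - t ^+ 2 * q.
  by field; rewrite gt_eqF.
move: mt he E0; set E := energy X U s; set G := energy x u _.
by move=> *; nra.
Qed.

(** Near-minimisers of the energy over the Fitzpatrick epigraph yield points z
    that satisfy every monotonicity inequality of (z, -z) against [A] up to a
    vanishing error. Strong convexity bounds them, and a cluster point satisfies
    the inequalities exactly, so that maximality applies. *)
Lemma minty_origin : exists z, A z (- z).
Proof.
(* The error is squared so that it is still small after division by the step
   length 1 / (n + 1) along the segment. *)
pose e (n : nat) : R := n.+1%:R^-1 ^+ 2.
have n0 n : 0 < n.+1%:R^-1 :> R by rewrite invr_gt0.
have n1 n : n.+1%:R^-1 <= 1 :> R by rewrite invf_le1 // ler1n.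
have e0 n : 0 < e n by rewrite exprn_gt0.
have e1 n : e n <= 1 by rewrite exprn_ile1 // ltW.
have /choice [k hk] : forall n, exists k : V * V * R,
    fitz k.1.1 k.1.2 k.2 /\ energy k.1.1 k.1.2 k.2 <= m + e n.
  move=> n; have [_ [X [U [s [h ->]]]] lt] := inf_adherent (e0 n) has_inf_energies.
  by exists (X, U, s); split=> //=; exact: ltW.
pose W n := (k n).1.1 - (k n).1.2; pose z n := 2^-1 *: W n.
have Wb n : sqn (W n) <= 2 * (sqn (W n - W 0%N) + sqn (W 0%N)).
  by rewrite -{1}(subrK (W 0%N) (W n)) sqnD_le.
(* The midpoint of two near-minimisers has energy at least m. *)
have W16 n : sqn (W n - W 0%N) <= 16.
  have h2 : 0 <= (2^-1 : R) <= 1 by apply/andP; split; lra.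
  have := m_le (fitz_convex h2 (hk 0%N).1 (hk n).1).
  rewrite energy_segment -/(W n) -/(W 0%N).
  have := (hk 0%N).2; have := (hk n).2; have := e1 0%N; have := e1 n.
  set a := energy _ _ _; set b := energy _ _ _ => *; lra.
have zb n : sqn (z n) <= 8 + sqn (W 0%N).
  have -> : sqn (z n) = sqn (W n) / 4 by rewrite /z /sqn !dotE; field.
  have := Wb n; have := W16 n.
  have := sqn_ge0 (W 0%N); lra.
have [zl hz] := bounded_cluster zb; exists zl.
(* C bounds the second-order term of [near_optimal] for the point (x, u). *)
apply: (maximal_mem maxA) => x u Axu.
rewrite -opprB dotNl -dotNr opprB opprK leNgt; apply/negP => neg.
set g := dot _ _ in neg; pose c := (x - u) - 2 *: zl.
pose C := 2 * (sqn (x - u) + 2 * (16 + sqn (W 0%N))) / 4.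
have C0 : 0 <= C.
  by have := sqn_ge0 (x - u); have := sqn_ge0 (W 0%N); rewrite /C; lra.
have c0 : 0 < sqn c + 1 by rewrite ltr_wpDl // sqn_ge0.
have [N hN] : exists N : nat, (1 + C) / (- g / 2) < N%:R.
  exists (Num.truncn ((1 + C) / (- g / 2))).+1; exact: truncnS_gt.
pose del := - g / 2 / (sqn c + 1).
have del0 : 0 < del by rewrite divr_gt0 // divr_gt0 // oppr_gt0.
have [] := hz (del * (- g / 2)) N.
  by rewrite mulr_gt0 // divr_gt0 // oppr_gt0.
move=> n Nn hn.
have tn : 0 < (n.+1%:R^-1 : R) <= 1 by rewrite n0 n1.
have := near_optimal (erefl (z n)) tn Axu (hk n).1 (hk n).2; rewrite -/(W n).
set t := n.+1%:R^-1 in tn *.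
have -> : e n / t = t by rewrite /e -/t; field; rewrite gt_eqF //; case/andP: tn.
have qC : sqn ((x - u) - W n) / 4 <= C.
  have := sqnD_le (x - u) (- W n); rewrite sqnN; have := Wb n; have := W16 n.
  rewrite /C; lra.
have -> : dot (x - z n) (u + z n) = g + dot c (z n - zl) - sqn (z n - zl).
  rewrite /g /c; move: (z n) => y.
  by rewrite /sqn !dotE !(dotC y) !(dotC u) !(dotC zl); ring.
have dc := dot_young c (z n - zl) del0.
have d1 : del * sqn c <= - g / 2.
  rewrite /del mulrAC ler_pdivrMr // ler_pM2l; lra.
have d2 : sqn (z n - zl) / del < - g / 2 by rewrite ltr_pdivrMr // mulrC.
have tC : t * (1 + C) < - g / 2.
  have g2 : 0 < - g / 2 by lra.
  rewrite mulrC ltr_pdivrMr // mulrC -ltr_pdivrMr //.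
  by apply: lt_trans hN _; rewrite ltr_nat ltnS.
have := sqn_ge0 (z n - zl); case/andP: tn => t0 _.
have : t * (sqn ((x - u) - W n) / 4) <= t * C by rewrite ler_pM2l.
lra.
Qed.

End Minty.

Section ResolventTheory.
Context (R : realType) (d : nat).
Notation V := 'rV[R]_d.
Implicit Types (A B : setop R d) (u v w x y z : V) (alpha : R).

Lemma maximal_affine alpha A z : 0 < alpha -> maximal_monotone A ->
  maximal_monotone (fun x => [set w | exists2 u, A x u & w = alpha *: u - z]).
Proof.
move=> a0 maxA; set A' := fun x => _.
have A'E x u : A x u -> A' x (alpha *: u - z) by exists u.
have aff u v : alpha *: u - z - (alpha *: v - z) = alpha *: (u - v).
  by rewrite opprB addrA subrK scalerBr.
split=> [x y w1 w2 [u Axu ->] [v Ayv ->]|B mB A'B].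
  by rewrite aff dotZr mulr_ge0 ?(ltW a0) //; exact: maxA.1.
apply/funext => x; apply/seteqP; split; last exact: A'B.
move=> w Bxw; have wE : w = alpha *: (alpha^-1 *: (w + z)) - z.
  by rewrite scalerA divff ?gt_eqF // scale1r addrK.
exists (alpha^-1 *: (w + z)) => //; apply: (maximal_mem maxA) => y v Ayv.
have := mB _ _ _ _ Bxw (A'B _ _ (A'E _ _ Ayv)).
by rewrite {1}wE aff dotZr pmulr_rge0.
Qed.

(** Minty's theorem, reduced to the case of [minty_origin] by the change of
    operator of [maximal_affine]. *)
Lemma resolventP alpha (A : maxmon R d) z : 0 < alpha ->
  exists2 u, maxmon_op A (resolvent alpha A z) u & resolvent alpha A z + alpha *: u = z.
Proof.
move=> a0; have [x [u Axu e]] := minty_origin (maximal_affine z a0 (maxmonP A)).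
have zE : x + alpha *: u = z by rewrite -[x]opprK e opprB subrK.
by exists u; rewrite -zE (resolventE a0 (maxmonP A).1 Axu).
Qed.

(** With z = x + alpha u and w = y + alpha v, the reflections are x - alpha u
    and y - alpha v, and the two squared distances differ by
    4 alpha <x - y, u - v>. *)
Lemma reflected_nonexpansive alpha (A : maxmon R d) z w : 0 < alpha ->
  sqn (reflected alpha A z - reflected alpha A w) <= sqn (z - w).
Proof.
move=> a0; have [u Axu zE] := resolventP A z a0.
have [v Ayv wE] := resolventP A w a0; rewrite /reflected.
move: (resolvent alpha A z) (resolvent alpha A w) Axu Ayv zE wE.
move=> x y Axu Ayv <- <-; have := (maxmonP A).1 _ _ _ _ Axu Ayv => mono.
have -> : 2 *: x - (x + alpha *: u) - (2 *: y - (y + alpha *: v))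
          = (x - y) - alpha *: (u - v).
  by rewrite !scaler_nat !mulr2n; apply/rowP => i; rewrite !mxE; ring.
have -> : x + alpha *: u - (y + alpha *: v) = (x - y) + alpha *: (u - v).
  by apply/rowP => i; rewrite !mxE; ring.
have := mulr_ge0 (ltW a0) mono; move: (x - y) (u - v) => p q.
by rewrite /sqn !dotE (dotC q p); lra.
Qed.

End ResolventTheory.

(** * Test operators *)

Section TestOperators.
Context (R : realType) (d : nat).
Notation V := 'rV[R]_d.
Implicit Types (A B : setop R d) (u v w x y z : V) (alpha t : R).

Definition cst_op u : setop R d := fun _ => [set u].

(** The normal cone of a singleton. *)
Definition point_op p : setop R d := fun x => [set u | x = p].

Lemma cst_op_maximal u : maximal_monotone (cst_op u).
Proof.
apply: (@surjective_maximal _ _ 1) => // [x y _ _ -> ->|z].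
  by rewrite subrr dotC dot0l.
by exists (z - u), u; rewrite scale1r subrK.
Qed.

Lemma point_op_maximal p : maximal_monotone (point_op p).
Proof.
apply: (@surjective_maximal _ _ 1) => // [x y u v -> ->|z].
  by rewrite subrr dot0l.
by exists p, (z - p); split; rewrite // scale1r addrC subrK.
Qed.

Definition cst_mm u := MaxMon (cst_op_maximal u).
Definition point_mm p := MaxMon (point_op_maximal p).

Lemma resolvent_cst alpha u z : 0 < alpha ->
  resolvent alpha (cst_mm u) z = z - alpha *: u.
Proof.
move=> a0; rewrite -{1}(subrK (alpha *: u) z).
by apply: resolventE => //; case: (cst_op_maximal u).
Qed.

Lemma resolvent_point alpha p z : 0 < alpha -> resolvent alpha (point_mm p) z = p.
Proof.
move=> a0; have -> : z = p + alpha *: (alpha^-1 *: (z - p)).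
  by rewrite scalerA divff ?gt_eqF // scale1r addrC subrK.
by apply: resolventE => //; case: (point_op_maximal p).
Qed.

Context (i j : 'I_d) (ij : i != j).

(** The quarter turn of the coordinate plane (i, j), extended by zero. *)
Definition turn x : V :=
  \row_k (if k == i then x 0 j else if k == j then - x 0 i else 0).

Definition turn_op t : setop R d := fun x => [set t *: turn x].

Lemma turn_i x : turn x 0 i = x 0 j.
Proof. by rewrite mxE eqxx. Qed.

Lemma turn_j x : turn x 0 j = - x 0 i.
Proof. by rewrite mxE eq_sym (negPf ij) eqxx. Qed.

Lemma turnB x y : turn x - turn y = turn (x - y).
Proof.
by apply/rowP => k; rewrite !mxE; case: eqP => // _; case: eqP => // _; ring.
Qed.

Lemma turn0 : turn 0 = 0.
Proof. by have := turnB 0 0; rewrite !subrr. Qed.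

Lemma dot_turn x : dot x (turn x) = 0.
Proof.
rewrite /dot (bigD1 i) //= (bigD1 j) /=; last by rewrite eq_sym.
rewrite big1 ?turn_i ?turn_j; first by ring.
by move=> k /andP[/negPf ki /negPf kj]; rewrite mxE ki kj mulr0.
Qed.

Lemma turn_surjective t z : exists2 x, x + t *: turn x = z &
  x 0 i = (z 0 i - t * z 0 j) / (1 + t ^+ 2) /\
  x 0 j = (z 0 j + t * z 0 i) / (1 + t ^+ 2).
Proof.
have t0 : 1 + t ^+ 2 != 0 by rewrite gt_eqF // ltr_pwDl // sqr_ge0.
pose x : V := \row_k (if k == i then (z 0 i - t * z 0 j) / (1 + t ^+ 2)
  else if k == j then (z 0 j + t * z 0 i) / (1 + t ^+ 2) else z 0 k).
have xi : x 0 i = (z 0 i - t * z 0 j) / (1 + t ^+ 2) by rewrite mxE eqxx.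
have xj : x 0 j = (z 0 j + t * z 0 i) / (1 + t ^+ 2).
  by rewrite mxE eq_sym (negPf ij) eqxx.
exists x => //; apply/rowP => k.
rewrite mxE [X in _ + X]mxE [turn x 0 k]mxE xi xj [x 0 k]mxE.
case: eqP => [->|_]; first by field.
case: eqP => [->|_]; first by field.
by rewrite mulr0 addr0.
Qed.

Lemma turn_op_maximal t : maximal_monotone (turn_op t).
Proof.
apply: (@surjective_maximal _ _ 1) => // [x y _ _ -> ->|z].
  by rewrite -scalerBr turnB dotZr dot_turn mulr0.
have [x xz _] := turn_surjective t z.
by exists x, (t *: turn x); rewrite scale1r.
Qed.

Definition turn_mm t := MaxMon (turn_op_maximal t).

(** In the complex coordinate z_i + i z_j of the plane, this resolvent divides
    by 1 - i t. *)
Lemma resolvent_turn alpha t z : 0 < alpha ->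
  let x := resolvent alpha (turn_mm (t / alpha)) z in
  x 0 i = (z 0 i - t * z 0 j) / (1 + t ^+ 2) /\
  x 0 j = (z 0 j + t * z 0 i) / (1 + t ^+ 2).
Proof.
move=> a0 /=; have [x xz xij] := turn_surjective t z.
suff -> : resolvent alpha (turn_op (t / alpha)) z = x by [].
rewrite -xz; have -> : t *: turn x = alpha *: ((t / alpha) *: turn x).
  by rewrite scalerA mulrCA divff ?gt_eqF // mulr1.
by apply: resolventE => //; case: (turn_op_maximal (t / alpha)).
Qed.

End TestOperators.

(** * Averaged iteration of a nonexpansive map *)

Section Averaged.
Context (R : realType) (d : nat).
Notation V := 'rV[R]_d.
Context (N : V -> V).
Context (N_nonexpansive : forall z w, sqn (N z - N w) <= sqn (z - w)).
Context (l : R) (l01 : 0 < l < 1).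

Let T z := (1 - l) *: z + l *: N z.

Let T_decrease p z : N p = p ->
  sqn (T z - p) <= sqn (z - p) - l * (1 - l) * sqn (N z - z).
Proof.
move=> Np; have [l0 l1] := andP l01.
have -> : T z - p = (1 - l) *: (z - p) + l *: (N z - p).
  by apply/rowP => i; rewrite !mxE; ring.
rewrite sqn_segment.
have -> : N z - p - (z - p) = N z - z by rewrite opprB addrA subrK.
have := N_nonexpansive z p; rewrite Np => h.
by have := ler_wpM2l (ltW l0) h; lra.
Qed.

Let T_nonincreasing p z0 : N p = p ->
  nonincreasing_seq (fun k => sqn (iter k T z0 - p)).
Proof.
move=> Np; apply/nonincreasing_seqP => k /=.
have := T_decrease (iter k T z0) Np; have := sqn_ge0 (N (iter k T z0) - iter k T z0).
have [l0 l1] := andP l01 => h0 h.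
have : 0 <= l * (1 - l) * sqn (N (iter k T z0) - iter k T z0).
  by rewrite !mulr_ge0 // ltW // subr_gt0.
lra.
Qed.

(** Krasnoselskii-Mann. The distance to a fixed point decreases by at least a
    multiple of the squared residual, so the residuals tend to 0 and a cluster
    point of the iterates is a fixed point; the distance to that point is
    nonincreasing as well, hence tends to 0. *)
Lemma averaged_iterates_cvg p z0 : N p = p ->
  exists2 zs, N zs = zs & iter k T z0 @[k --> \oo] --> zs.
Proof.
move=> Np; have [l0 l1] := andP l01.
pose z k := iter k T z0; pose f k := sqn (z k - p).
have fdec : nonincreasing_seq f by exact: T_nonincreasing.
have f_res k : l * (1 - l) * sqn (N (z k) - z k) <= f k - f k.+1.
  by have := T_decrease (z k) Np; rewrite /f /=; lra.
have fcv : cvgn f.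
  by apply: nonincreasing_is_cvgn => //; exists 0 => _ [k _ <-]; exact: sqn_ge0.
have f0 : f k - f k.+1 @[k --> \oo] --> (0 : R).
  rewrite -(subrr (limn f)); apply: cvgB => //.
  by move: fcv; rewrite -(cvg_shiftS f).
have c0 : 0 < l * (1 - l) by rewrite mulr_gt0 // subr_gt0.
have res e : 0 < e -> exists K, forall k, (K <= k)%N -> sqn (N (z k) - z k) < e.
  move=> e0; move/cvgrPdist_lt : f0 => /(_ (e * (l * (1 - l)))).
  case=> [|K _ hK]; first exact: mulr_gt0.
  exists K => k /hK /=; rewrite sub0r normrN => h.
  rewrite -(ltr_pM2l c0) (le_lt_trans (f_res k)) // mulrC.
  exact: le_lt_trans (ler_norm _) h.
have zb k : sqn (z k) <= 2 * (f 0%N + sqn p).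
  rewrite -[z k](subrK p); apply: le_trans (sqnD_le _ _) _.
  by rewrite ler_pM2l // lerD2r; exact: fdec.
have [zs hzs] := bounded_cluster zb.
have Nzs : N zs = zs.
  apply/eqP; rewrite -subr_eq0; apply/eqP/sqn_eq0; rewrite leNgt.
  apply/negP => r0; set r := sqn _ in r0.
  have e0 : 0 < r / 16 by rewrite divr_gt0.
  have [K hK] := res _ e0; have [k Kk hk] := hzs _ K e0.
  have : r <= 2 * (sqn (N zs - N (z k)) + 2 * (sqn (N (z k) - z k) + sqn (z k - zs))).
    have -> : r = sqn ((N zs - N (z k)) + ((N (z k) - z k) + (z k - zs))).
      by rewrite !addrA !subrK.
    apply: le_trans (sqnD_le _ _) _.
    by rewrite ler_pM2l // lerD2l sqnD_le.
  have := N_nonexpansive zs (z k); rewrite -[sqn (zs - z k)]sqnN opprB.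
  by have := hK _ Kk; lra.
exists zs => //; apply: cvg_sqn => e e0.
have [K _ hK] := hzs e 0%N e0; exists K => k Kk.
by apply: le_lt_trans hK; exact: (T_nonincreasing z0 Nzs).
Qed.

End Averaged.

(** * Douglas-Rachford splittings *)

Section ClassF.
Context (R : realType) (d : nat).
Implicit Types (F G : opmap R d).

Lemma map_scale1 F : map_scale 1 F = F.
Proof. by do 3!apply/funext => ?; rewrite /map_scale scale1r. Qed.

(** Every level contains the previous one because F = 1 F. *)
Lemma Fclass_leq i j F : (i <= j)%N -> Fclass_ i F -> Fclass_ j F.
Proof.
move=> /subnKC <-; elim: (j - i)%N => [|k IH]; first by rewrite addn0.
move=> /IH Fk; rewrite addnS /=; right; right.
by exists F, 1; rewrite map_scale1.
Qed.

Lemma Fclass_common F G : Fclass F -> Fclass G ->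
  exists i, Fclass_ i F /\ Fclass_ i G.
Proof.
move=> [i _ Fi] [j _ Gj]; exists (maxn i j); split.
  exact: Fclass_leq (leq_maxl i j) Fi.
exact: Fclass_leq (leq_maxr i j) Gj.
Qed.

Lemma Fclass_id : Fclass (@Defs.map_id R d).
Proof. by exists 0%N => //; left. Qed.

Lemma Fclass_J1 alpha : 0 < alpha -> Fclass (@map_J1 R d alpha).
Proof. by move=> a0; exists 0%N => //; right; left; exists alpha. Qed.

Lemma Fclass_J2 alpha : 0 < alpha -> Fclass (@map_J2 R d alpha).
Proof. by move=> a0; exists 0%N => //; right; right; exists alpha. Qed.

Lemma Fclass_add F G : Fclass F -> Fclass G -> Fclass (map_add F G).
Proof.
move=> hF hG; have [i [Fi Gi]] := Fclass_common hF hG.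
by exists i.+1 => //=; left; exists F, G.
Qed.

Lemma Fclass_comp F G : Fclass F -> Fclass G -> Fclass (Defs.map_comp F G).
Proof.
move=> hF hG; have [i [Fi Gi]] := Fclass_common hF hG.
by exists i.+1 => //=; right; left; exists F, G.
Qed.

Lemma Fclass_scale c F : Fclass F -> Fclass (map_scale c F).
Proof. by move=> [i _ Fi]; exists i.+1 => //=; right; right; exists F, c. Qed.

Lemma Fclass_swap F : Fclass F -> Fclass (fun A B z => F B A z).
Proof.
case=> i _; elim: i F => [|i IH] F /=.
- case=> [->|[[a a0 ->]|[a a0 ->]]].
  + exact: Fclass_id.
  + exact: Fclass_J2.
  + exact: Fclass_J1.
- case=> [[G [H [/IH hG [/IH hH ->]]]]|[[G [H [/IH hG [/IH hH ->]]]]|[G [c [/IH hG ->]]]]].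
  + exact: (Fclass_add hG hH).
  + exact: (Fclass_comp hG hH).
  + exact: (Fclass_scale c hG).
Qed.

End ClassF.

Section Invariance.
Context (R : realType) (d : nat).
Notation V := 'rV[R]_d.
Implicit Types (A B : setop R d) (z : V) (alpha beta : R) (p : seq (step R)).
Implicit Types (P Q : opmap R d * opmap R d).

Definition splitting P :=
  resolvent_splitting P.1 P.2 /\ frugal P.1 P.2 /\
  converges_unconditionally P.1 P.2.

Lemma add_opC A B : add_op A B = add_op B A.
Proof.
apply/funext => x; apply/seteqP.
by split=> w [u [v [? [? ->]]]]; exists v, u; rewrite addrC.
Qed.

Definition swap_step (s : step R) : step R :=
  match s with
  | StepJA i => StepJB R i
  | StepJB i => StepJA R i
  | _ => s
  end.

Lemma run_swap alpha beta A B p z :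
  run beta alpha A B (map swap_step p) z = run alpha beta B A p z.
Proof.
rewrite /run; elim: p [:: z] => //= s p IH h; rewrite IH.
by case: s.
Qed.

Lemma procedure_ok_swap n p : procedure_ok n (map swap_step p) = procedure_ok n p.
Proof. by elim: p n => //= s p IH n; rewrite IH; case: s. Qed.

Lemma count_swap_JA p : count (@is_JA R) (map swap_step p) = count (@is_JB R) p.
Proof. by rewrite count_map; apply: eq_count => -[]. Qed.

Lemma count_swap_JB p : count (@is_JB R) (map swap_step p) = count (@is_JA R) p.
Proof. by rewrite count_map; apply: eq_count => -[]. Qed.

Lemma splitting_swap P : splitting P -> splitting (Defs.swap_pair P).
Proof.
case: P => T S [[fpe FT FS] [[al [be [al0 [be0 [p [iT [iS [ok cA cB iTS out]]]]]]]] cv]].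
split; [split=> /=|split].
- by move=> A B x; rewrite add_opC; exact: (fpe B A x).
- exact: Fclass_swap.
- exact: Fclass_swap.
- exists be, al; split=> //; split=> //; exists (map swap_step p), iT, iS.
  split=> //=; rewrite ?count_swap_JA ?count_swap_JB ?procedure_ok_swap ?size_map //.
  by move=> A B z; rewrite run_swap; exact: out.
- by move=> A B zAB z0 /=; rewrite add_opC; apply: cv; rewrite add_opC.
Qed.

(** The same step, when one more vector stands in front of the history. *)
Definition shift_step (s : step R) : step R :=
  match s with
  | StepScale c i => StepScale c i.+1
  | StepAdd i j => StepAdd R i.+1 j.+1
  | StepJA i => StepJA R i.+1
  | StepJB i => StepJB R i.+1
  end.

Lemma run_shift alpha beta A B p (x : V) (h : seq V) :
  foldl (fun h s => rcons h (eval_step alpha beta A B h s)) (x :: h)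
    (map shift_step p)
  = x :: foldl (fun h s => rcons h (eval_step alpha beta A B h s)) h p.
Proof. by elim: p h => //= s p IH h; rewrite -IH; case: s. Qed.

Lemma procedure_ok_shift n p :
  procedure_ok n.+1 (map shift_step p) = procedure_ok n p.
Proof. by elim: p n => //= s p IH n; rewrite IH; case: s. Qed.

Lemma procedure_ok_rcons n p s :
  procedure_ok n (rcons p s) = procedure_ok n p && step_ok (n + size p) s.
Proof.
elim: p n => [|s' p IH] n /=; first by rewrite addn0 andbT.
by rewrite IH addSnnS andbA.
Qed.

Lemma size_run alpha beta A B p z : size (run alpha beta A B p z) = (size p).+1.
Proof.
suff gen h : size (foldl (fun h s => rcons h (eval_step alpha beta A B h s)) h p)
    = (size h + size p)%N by exact: gen.
by elim: p h => [|s p IH] h /=; rewrite ?addn0 // IH size_rcons addSnnS.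
Qed.

(** The scaled pair first computes a^-1 z, then runs the procedure behind one
    more vector, and finally multiplies the output of T by a. *)
Lemma frugal_scale a P : frugal P.1 P.2 ->
  frugal (Defs.scale_pair a P).1 (Defs.scale_pair a P).2.
Proof.
case: P => T S [al [be [al0 [be0 [p [iT [iS [ok cA cB /andP[iTp iSp] out]]]]]]]].
exists al, be; split=> //; split=> //.
exists (StepScale a^-1 0 :: rcons (map shift_step p) (StepScale a iT.+1)).
exists (size p).+2, iS.+1; split.
- by rewrite /= procedure_ok_rcons size_map procedure_ok_shift ok /= addSn add1n ltnS.
- by rewrite /= -cats1 count_cat count_map /= !addn0 -[RHS]cA; apply: eq_count => -[].
- by rewrite /= -cats1 count_cat count_map /= !addn0 -[RHS]cB; apply: eq_count => -[].
- by rewrite /= size_rcons size_map !ltnS leqnn /= ltnW.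
move=> A B z /=; have [/= -> ->] := out A B (a^-1 *: z).
have -> : run al be A B (StepScale a^-1 0 :: rcons (map shift_step p) (StepScale a iT.+1)) z
  = rcons (z :: run al be A B p (a^-1 *: z))
      (a *: nth 0 (run al be A B p (a^-1 *: z)) iT).
  by rewrite {1}/run /= -cats1 foldl_cat run_shift.
rewrite !nth_rcons /= size_run ltnn eqxx; split=> //.
by rewrite ltnS iSp.
Qed.

Lemma iter_scale a (F : V -> V) k z : a != 0 ->
  iter k (fun x => a *: F (a^-1 *: x)) z = a *: iter k F (a^-1 *: z).
Proof.
move=> a0; elim: k => [|k IH] /=; first by rewrite scalerA divff // scale1r.
by rewrite IH scalerA mulVf // scale1r.
Qed.

Lemma splitting_scale a P : a != 0 -> splitting P -> splitting (Defs.scale_pair a P).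
Proof.
move=> a0 [[fpe FT FS] [fr cv]].
have aK (z : V) : a^-1 *: (a *: z) = z by rewrite scalerA mulVf // scale1r.
split; [split=> /=|split; [exact: frugal_scale|]].
- move=> A B x; rewrite -fpe; split=> -[z [Tz Sz]].
  + by exists (a^-1 *: z); split=> //; rewrite -{2}Tz aK.
  + by exists (a *: z); rewrite aK Tz.
- exact: (Fclass_scale a (Fclass_comp FT (Fclass_scale a^-1 (Fclass_id R d)))).
- exact: (Fclass_comp FS (Fclass_scale a^-1 (Fclass_id R d))).
- move=> A B zAB z0; have [zs [lim Szs]] := cv A B zAB (a^-1 *: z0).
  exists (a *: zs); split=> /=; last by rewrite aK.
  have -> : (fun k => iter k (fun z => a *: P.1 A B (a^-1 *: z)) z0)
          = (fun k => a *: iter k (P.1 A B) (a^-1 *: z0)).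
    by apply/funext => k; rewrite iter_scale.
  exact: cvgZr.
Qed.

End Invariance.

Section DouglasRachford.
Context (R : realType) (d : nat).
Notation V := 'rV[R]_d.
Implicit Types (A B : maxmon R d) (z : V).
Context (alpha theta eta : R).
Context (alpha0 : 0 < alpha) (theta0 : 0 < theta) (theta2 : theta < 2).

Definition drs_map : opmap R d := fun A B z =>
  (1 - theta / 2) *: z
  + (theta / 2) *: reflected alpha B (reflected alpha A z).

Definition drs_solution : opmap R d := fun A B z =>
  eta *: resolvent alpha A z
  + (1 - eta) *: resolvent alpha B (reflected alpha A z).

Lemma drs_mapE A B z : drs_map A B z = z + theta *:
  (resolvent alpha B (reflected alpha A z) - resolvent alpha A z).
Proof.
rewrite /drs_map {1}/reflected; set b := resolvent alpha B _.
by rewrite /reflected; apply/rowP => i; rewrite !mxE; field.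
Qed.

(** A fixed point z satisfies a = b; then (z - a) / alpha in A a and
    (a - z) / alpha in B a are opposite. Conversely, a zero x with u in A x and
    -u in B x comes from z = x + alpha u. *)
Lemma drs_fixed_point_encoding : fixed_point_encoding drs_map drs_solution.
Proof.
move=> A B x; split=> [[z [Tz Sz]]|[u [v [Au [Bv uv]]]]].
- have ba : resolvent alpha B (reflected alpha A z) = resolvent alpha A z.
    apply/eqP; rewrite -subr_eq0.
    have /eqP := Tz; rewrite drs_mapE -subr_eq0 addrC addKr scaler_eq0.
    by rewrite gt_eqF.
  move: Sz; rewrite /drs_solution ba -scalerDl addrC subrK scale1r => <-.
  have [u Au zE] := resolventP A z alpha0.
  have [v Bv] := resolventP B (reflected alpha A z) alpha0.
  rewrite ba in Bv *; rewrite /reflected -{3}zE => e.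
  exists u, v; split=> //; split=> //.
  have /eqP : alpha *: (u + v) = 0.
    by apply/rowP => i; have /rowP/(_ i) := e; rewrite !mxE; lra.
  by rewrite scaler_eq0 gt_eqF //= => /eqP.
- have a0 := alpha0; have xz : resolvent alpha A (x + alpha *: u) = x.
    exact: (resolventE a0 (maxmonP A).1 Au).
  have xw : resolvent alpha B (reflected alpha A (x + alpha *: u)) = x.
    rewrite /reflected xz.
    have -> : 2 *: x - (x + alpha *: u) = x + alpha *: v.
      have -> : v = - u by apply/eqP; rewrite -addr_eq0 addrC -uv.
      by apply/rowP => i; rewrite !mxE; ring.
    exact: (resolventE a0 (maxmonP B).1 Bv).
  exists (x + alpha *: u); rewrite drs_mapE /drs_solution xw xz subrr scaler0.
  by rewrite addr0 -scalerDl addrCA subrr addr0 scale1r.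
Qed.

Lemma Fclass_reflected1 : Fclass (fun A B z => reflected alpha A z).
Proof.
have -> : (fun A B z => reflected alpha A z)
        = map_add (map_scale 2 (@map_J1 R d alpha)) (map_scale (-1) (@Defs.map_id R d)).
  by do 3!apply/funext => ?; rewrite /map_add /map_scale scaleN1r.
apply: Fclass_add; apply: Fclass_scale; [exact: Fclass_J1|exact: Fclass_id].
Qed.

Lemma Fclass_drs_solution : Fclass drs_solution.
Proof.
have J2R := Fclass_comp (Fclass_J2 d alpha0) Fclass_reflected1.
exact: (Fclass_add (Fclass_scale eta (Fclass_J1 d alpha0)) (Fclass_scale (1 - eta) J2R)).
Qed.

Lemma Fclass_drs_map : Fclass drs_map.
Proof.
have R2R := Fclass_comp (Fclass_swap Fclass_reflected1) Fclass_reflected1.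
exact: (Fclass_add (Fclass_scale (1 - theta / 2) (Fclass_id R d))
         (Fclass_scale (theta / 2) R2R)).
Qed.

Lemma frugal_drs : frugal drs_map drs_solution.
Proof.
exists alpha, alpha; split=> //; split=> //.
exists [:: StepJA R 0; StepScale 2 1; StepScale (-1) 0; StepAdd R 2 3;
  StepJB R 4; StepScale theta 5; StepScale (- theta) 1; StepAdd R 0 6;
  StepAdd R 8 7; StepScale eta 1; StepScale (1 - eta) 5; StepAdd R 10 11].
exists 9%N, 12%N; split=> // A B z.
rewrite drs_mapE /run /= scaleN1r; split=> //.
by rewrite scalerBr scaleNr addrA.
Qed.

Lemma drs_converges : converges_unconditionally drs_map drs_solution.
Proof.
move=> A B [x zx] z0; have [z [Tz _]] := (drs_fixed_point_encoding A B x).2 zx.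
pose N w := reflected alpha B (reflected alpha A w).
have th01 : 0 < theta / 2 < 1 by rewrite divr_gt0 //= ltr_pdivrMr // mul1r.
have Nne w w' : sqn (N w - N w') <= sqn (w - w').
  by apply: le_trans (reflected_nonexpansive _ _ _ _) (reflected_nonexpansive _ _ _ _).
have NT w : N w = w -> drs_map A B w = w.
  by move=> Nw; rewrite /drs_map -/(N w) Nw -scalerDl subrK scale1r.
have TN : N z = z.
  have th0 : theta / 2 != 0 by rewrite gt_eqF //; case/andP: th01.
  apply: (scalerI th0); move: Tz; rewrite /drs_map -/(N z).
  move: (N z) => y Tz.
  by apply/rowP => i; have /rowP/(_ i) := Tz; rewrite !mxE => h; lra.
have [zs Nzs lim] := averaged_iterates_cvg Nne th01 z0 TN.
exists zs; split; first exact: lim.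
by apply/drs_fixed_point_encoding; exists zs; split=> //; exact: NT.
Qed.

Lemma drs_splitting : splitting (drs_map, drs_solution).
Proof.
split; last by split; [exact: frugal_drs|exact: drs_converges].
split; [exact: drs_fixed_point_encoding|exact: Fclass_drs_map|exact: Fclass_drs_solution].
Qed.

End DouglasRachford.

(** * Normal form of a frugal procedure *)

Section NormalForm.
Context (R : realType) (d : nat).
Notation V := 'rV[R]_d.
Notation coef := (R * R * R)%type.
Implicit Types (z a b : V) (alpha beta : R) (p : seq (step R)).
Implicit Types (k : coef) (C : seq coef) (T S : opmap R d).

(** A vector available during a run is a combination of the input z and of the
    outputs a, b of the two resolvents; [coef] lists the three coefficients. *)
Definition lincomb z a b k : V := k.1.1 *: z + k.1.2 *: a + k.2 *: b.

Definition coef0 : coef := (0, 0, 0).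
Definition coefD k k' : coef := (k.1.1 + k'.1.1, k.1.2 + k'.1.2, k.2 + k'.2).
Definition coefZ c k : coef := (c * k.1.1, c * k.1.2, c * k.2).

(** Symbolic execution of the linear steps. *)
Definition coef_step C (s : step R) : coef :=
  match s with
  | StepScale c i => coefZ c (nth coef0 C i)
  | StepAdd i j => coefD (nth coef0 C i) (nth coef0 C j)
  | _ => coef0
  end.

Definition coef_run C p := foldl (fun C s => rcons C (coef_step C s)) C p.

Definition is_res (s : step R) := is_JA s || is_JB s.

Lemma nth_lincomb z a b C i :
  nth 0 (map (lincomb z a b) C) i = lincomb z a b (nth coef0 C i).
Proof.
have [iC|iC] := ltnP i (size C); first by rewrite (nth_map coef0).
by rewrite !nth_default ?size_map // /lincomb !scale0r !addr0.
Qed.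

Lemma run_linear alpha beta A B z a b C p : all (predC is_res) p ->
  foldl (fun h s => rcons h (eval_step alpha beta A B h s))
    (map (lincomb z a b) C) p
  = map (lincomb z a b) (coef_run C p).
Proof.
elim: p C => //= s p IH C /andP[s_lin /IH {}IH].
rewrite /coef_run /= -/(coef_run _ p) -IH map_rcons; congr (foldl _ (rcons _ _) _).
case: s s_lin => //= [c i|i j] _; rewrite !nth_lincomb /lincomb /=.
  by rewrite !scalerDr !scalerA.
by rewrite !scalerDl addrACA [X in X + _ = _]addrACA.
Qed.

Lemma coef_run_all (P : pred coef) C p :
  P coef0 -> (forall k k', P k -> P k' -> P (coefD k k')) ->
  (forall c k, P k -> P (coefZ c k)) -> all P C -> all P (coef_run C p).
Proof.
move=> P0 PD PZ; elim: p C => //= s p IH C PC; apply: IH.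
have Pn i : P (nth coef0 C i).
  have [iC|iC] := ltnP i (size C); first exact: (all_nthP _ PC).
  by rewrite nth_default.
by rewrite all_rcons PC andbT; case: s => //= *; [exact: PZ|exact: PD].
Qed.

Definition two_step_form alpha beta (c : R) (pq : R * R) (t s : coef) T S :=
  forall (A B : maxmon R d) z,
    let a := resolvent alpha A (c *: z) in
    let b := resolvent beta B (pq.1 *: z + pq.2 *: a) in
    T A B z = lincomb z a b t /\ S A B z = lincomb z a b s.

(** Before the first resolvent only multiples of z are available, and before the
    second one only combinations of z and a. *)
Lemma run_two_step alpha beta p1 p2 p3 i j :
  all (predC is_res) p1 -> all (predC is_res) p2 -> all (predC is_res) p3 ->
  exists c pq (out : nat -> coef), forall (A B : setop R d) z,
    let a := resolvent alpha A (c *: z) in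
    let b := resolvent beta B (pq.1 *: z + pq.2 *: a) in
    forall n, nth 0 (run alpha beta A B
                  (p1 ++ StepJA R i :: p2 ++ StepJB R j :: p3) z) n
      = lincomb z a b (out n).
Proof.
move=> l1 l2 l3.
pose C1 := coef_run [:: (1, 0, 0)] p1.
pose C2 := coef_run (rcons C1 (0, 1, 0)) p2.
pose C3 := coef_run (rcons C2 (0, 0, 1)) p3.
pose P1 : pred coef := fun k => (k.1.2 == 0) && (k.2 == 0).
pose P2 : pred coef := fun k => k.2 == 0.
have C1P : all P1 C1.
  apply: coef_run_all; rewrite /P1 /= ?eqxx //.
    by move=> k k' /andP[/eqP -> /eqP ->] /andP[/eqP -> /eqP ->]; rewrite !addr0 eqxx.
  by move=> c k /andP[/eqP -> /eqP ->]; rewrite !mulr0 eqxx.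
have C2P : all P2 C2.
  apply: coef_run_all; rewrite /P2 /= ?eqxx //.
  - by move=> k k' /eqP -> /eqP ->; rewrite addr0.
  - by move=> c k /eqP ->; rewrite mulr0.
  - by rewrite all_rcons /= eqxx; apply: sub_all C1P => k /andP[].
have in1 z a b : lincomb z a b (nth coef0 C1 i) = (nth coef0 C1 i).1.1 *: z.
  have [iC|iC] := ltnP i (size C1); last first.
    by rewrite nth_default // /lincomb !scale0r !addr0.
  have /andP[/eqP e1 /eqP e2] := all_nthP coef0 C1P i iC.
  by rewrite /lincomb e1 e2 !scale0r !addr0.
have in2 z a b : lincomb z a b (nth coef0 C2 j)
    = (nth coef0 C2 j).1.1 *: z + (nth coef0 C2 j).1.2 *: a.
  have [jC|jC] := ltnP j (size C2); last first.
    by rewrite nth_default // /lincomb !scale0r !addr0.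
  have /eqP e2 := all_nthP coef0 C2P j jC.
  by rewrite /lincomb e2 !scale0r !addr0.
exists (nth coef0 C1 i).1.1, (nth coef0 C2 j).1, (nth coef0 C3).
move=> A B z a b n.
have -> : run alpha beta A B (p1 ++ StepJA R i :: p2 ++ StepJB R j :: p3) z
        = map (lincomb z a b) C3; last exact: nth_lincomb.
have z1 : lincomb z a b (1, 0, 0) = z by rewrite /lincomb !scale0r scale1r !addr0.
have a1 : lincomb z a b (0, 1, 0) = a by rewrite /lincomb !scale0r scale1r addr0 add0r.
have b1 : lincomb z a b (0, 0, 1) = b by rewrite /lincomb !scale0r scale1r !add0r.
have zC : [:: z] = map (lincomb z a b) [:: (1, 0, 0)] by rewrite /= z1.
have aC : rcons (map (lincomb z a b) C1) a = map (lincomb z a b) (rcons C1 (0, 1, 0)).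
  by rewrite map_rcons a1.
have bC : rcons (map (lincomb z a b) C2) b = map (lincomb z a b) (rcons C2 (0, 0, 1)).
  by rewrite map_rcons b1.
rewrite /run foldl_cat zC run_linear // -/C1 /= nth_lincomb in1 -/a aC.
rewrite foldl_cat run_linear // -/C2 /= nth_lincomb in2 -/b bC.
by rewrite run_linear.
Qed.

Lemma has_split (P : pred (step R)) p : has P p ->
  exists p1 s p2, [/\ p = p1 ++ s :: p2, all (predC P) p1 & P s].
Proof.
elim: p => //= s p IH; have [Ps _|Ps /=] := boolP (P s).
  by exists [::], s, p.
by case/IH => p1 [s' [p2 [-> l1 Ps']]]; exists (s :: p1), s', p2; rewrite /= Ps.
Qed.

Lemma count_is_res p :
  count is_res p = (count (@is_JA R) p + count (@is_JB R) p)%N.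
Proof. by elim: p => //= s p ->; case: s => /=; lia. Qed.

Lemma split_resolvents p :
  count (@is_JA R) p = 1%N -> count (@is_JB R) p = 1%N ->
  exists p1 p2 p3 i j, [/\ all (predC is_res) p1, all (predC is_res) p2,
    all (predC is_res) p3 &
    p = p1 ++ StepJA R i :: p2 ++ StepJB R j :: p3 \/
    p = p1 ++ StepJB R i :: p2 ++ StepJA R j :: p3].
Proof.
move=> cA cB; have := count_is_res p; rewrite cA cB => cp.
have /has_split [p1 [s1 [q [pE l1 r1]]]] : has is_res p by rewrite has_count cp.
have z1 : count is_res p1 = 0%N by apply/eqP; rewrite -leqn0 leqNgt -has_count -all_predC.
have cq : count is_res q = 1%N by move: cp; rewrite pE count_cat /= z1 r1; lia.
have /has_split [p2 [s2 [p3 [qE l2 r2]]]] : has is_res q by rewrite has_count cq.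
have z2 : count is_res p2 = 0%N by apply/eqP; rewrite -leqn0 leqNgt -has_count -all_predC.
have c3 : count is_res p3 = 0%N by move: cq; rewrite qE count_cat /= z2 r2; lia.
have l3 : all (predC is_res) p3 by rewrite all_predC has_count c3.
move: z1 z2 c3; rewrite !count_is_res => z1 z2 c3.
move: cA cB; rewrite pE qE !count_cat /= !count_cat /=.
case: s1 r1 pE => // i _ pE; case: s2 r2 qE => // j _ qE /=; try lia.
- by move=> _ _; exists p1, p2, p3, i, j; split=> //; left.
- by move=> _ _; exists p1, p2, p3, i, j; split=> //; right.
Qed.

Lemma frugal_two_step_form T S : frugal T S ->
  exists alpha beta c pq t s, [/\ 0 < alpha, 0 < beta &
    two_step_form alpha beta c pq t s T S \/
    two_step_form alpha beta c pq t s
      (fun A B z => T B A z) (fun A B z => S B A z)].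
Proof.
case=> al [be [al0 [be0 [p [iT [iS [ok cA cB _ out]]]]]]].
have [p1 [p2 [p3 [i [j [l1 l2 l3 [pE|pE]]]]]]] := split_resolvents cA cB.
- have [c [pq [w hw]]] := run_two_step al be i j l1 l2 l3.
  exists al, be, c, pq, (w iT), (w iS); split=> //; left=> A B z /=.
  by have [-> ->] := out A B z; rewrite pE !hw.
- have lin q : all (predC is_res) q -> all (predC is_res) (map (@swap_step R) q).
    by rewrite all_map; apply: sub_all => -[].
  have [c [pq [w hw]]] :=
    run_two_step be al i j (lin _ l1) (lin _ l2) (lin _ l3).
  exists be, al, c, pq, (w iT), (w iS); split=> //; right=> A B z /=.
  have [-> ->] := out B A z; rewrite -run_swap pE.
  by rewrite map_cat /= map_cat /= !hw.
Qed.

End NormalForm.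

(** * Rigidity of fixed-point encodings *)

Section Rigidity.
Context (R : realType) (d : nat) (i0 : 'I_d).
Notation V := 'rV[R]_d.
Context (alpha beta : R) (alpha0 : 0 < alpha) (beta0 : 0 < beta).
Context (c : R) (pq : R * R) (t s : R * R * R) (T S : opmap R d).
Context (form : two_step_form alpha beta c pq t s T S).
Context (enc : fixed_point_encoding T S).

Let e : V := const_mx 1.

Let e_inj : injective (fun k : R => k *: e).
Proof. by move=> k l /rowP/(_ i0); rewrite !mxE !mulr1. Qed.

Let lincombE (z x y : R) k :
  lincomb (z *: e) (x *: e) (y *: e) k = (k.1.1 * z + k.1.2 * x + k.2 * y) *: e.
Proof. by rewrite /lincomb !scalerA !scalerDl. Qed.

(** The two normal cones make (z e, x e, y e) occur in a run with the only
    possible solutions x e and y e. The two constant operators make the same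
    triple occur, and they have a common zero only if their values are opposite. *)
Let test z x y : (t.1.1 - 1) * z + t.1.2 * x + t.2 * y = 0 ->
  [/\ x = y, s.1.1 * z + s.1.2 * x + s.2 * y = x &
      (c * z - x) / alpha + (pq.1 * z + pq.2 * x - y) / beta = 0].
Proof.
move=> tz; have tzE : t.1.1 * z + t.1.2 * x + t.2 * y = z by lra.
have [Sx Sy] : s.1.1 * z + s.1.2 * x + s.2 * y = x /\
               s.1.1 * z + s.1.2 * x + s.2 * y = y.
  have := form (point_mm (x *: e)) (point_mm (y *: e)) (z *: e).
  rewrite /= !resolvent_point // !lincombE tzE => -[Tz Sz].
  have [u [v [Au [Bv _]]]] : add_op (point_mm (x *: e)) (point_mm (y *: e))
      ((s.1.1 * z + s.1.2 * x + s.2 * y) *: e) 0 by apply/enc; exists (z *: e).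
  by split; apply: e_inj.
split=> //; first by rewrite -Sx.
pose u := (c * z - x) / alpha; pose v := (pq.1 * z + pq.2 * x - y) / beta.
have := form (cst_mm (u *: e)) (cst_mm (v *: e)) (z *: e).
rewrite /= !resolvent_cst // !scalerA -!scalerBl.
have -> : c * z - alpha * u = x by rewrite /u; field; rewrite gt_eqF.
rewrite !scalerA -!scalerDl -!scalerBl.
have -> : pq.1 * z + pq.2 * x - beta * v = y by rewrite /v; field; rewrite gt_eqF.
rewrite !lincombE tzE => -[Tz Sz].
have [_ [_ [-> [-> uv]]]] : add_op (cst_mm (u *: e)) (cst_mm (v *: e))
    ((s.1.1 * z + s.1.2 * x + s.2 * y) *: e) 0 by apply/enc; exists (z *: e).
by apply: e_inj; rewrite scale0r scalerDl -uv.
Qed.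

(** The coefficients (z, x, y) that satisfy T z = z form a subspace of dimension
    at least 2, which by [test] lies in x = y and hence is this plane; the other
    two conclusions of [test], read on a basis of
    this plane, determine the remaining coefficients. *)
Lemma encoding_rigid : c != 0 /\ exists theta eta, theta != 0 /\
  forall (A B : maxmon R d) z,
    let a := resolvent alpha A (c *: z) in
    let b := resolvent beta B
               ((1 + beta / alpha) *: a - (beta / alpha) *: (c *: z)) in
    T A B z = z + theta *: (b - a) /\ S A B z = eta *: a + (1 - eta) *: b.
Proof.
have al0 : alpha != 0 by rewrite gt_eqF.
have be0 : beta != 0 by rewrite gt_eqF.
have t0 : t.1.1 = 1.
  by have [h _ _] := @test t.1.2 (1 - t.1.1) 0 ltac:(ring); lra.
have t12 : t.1.2 = - t.2.
  by have [h _ _] := @test 0 t.2 (- t.1.2) ltac:(ring); lra.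
have t2 : t.2 != 0.
  apply/eqP => t20; have [] := @test 0 1 0; first by rewrite t12 t20; ring.
  by lra.
have [_ s0 cp] := @test 1 0 0 ltac:(rewrite t0; ring).
have [_ s12 q] := @test 0 1 1 ltac:(rewrite t12; ring).
have s0E : s.1.1 = 0 by move: s0; rewrite !mulr0 mulr1 !addr0.
have s12E : s.2 = 1 - s.1.2 by move: s12; rewrite !mulr0 !mulr1 add0r; lra.
have pE : pq.1 = - (beta / alpha) * c.
  have -> : pq.1 = beta * ((c * 1 - 0) / alpha + (pq.1 * 1 + pq.2 * 0 - 0) / beta)
     - (beta / alpha) * c by field; rewrite al0 be0.
  by rewrite cp; ring.
have qE : pq.2 = 1 + beta / alpha.
  have -> : pq.2 = beta * ((c * 0 - 1) / alpha + (pq.1 * 0 + pq.2 * 1 - 1) / beta)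
     + 1 + beta / alpha by field; rewrite al0 be0.
  by rewrite q; ring.
have rhs (z a : V) : pq.1 *: z + pq.2 *: a
    = (1 + beta / alpha) *: a - (beta / alpha) *: (c *: z).
  by rewrite pE qE addrC scalerA mulNr scaleNr.
split.
  apply/eqP => c0.
  have [|z [_]] := (enc (cst_mm 0) (cst_mm 0) e).2.
    by exists 0, 0; rewrite addr0.
  have [_ ->] := form (cst_mm 0) (cst_mm 0) z.
  rewrite /= rhs !resolvent_cst // c0 !scale0r !scaler0 !subr0 !scaler0.
  rewrite /lincomb !scaler0 !addr0 s0E scale0r => /rowP/(_ i0).
  by rewrite !mxE => /esym/eqP; rewrite oner_eq0.
exists t.2, s.1.2; split=> // A B z a b.
have [-> ->] := form A B z; rewrite rhs -/a -/b /lincomb.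
rewrite t0 t12 s0E s12E scale0r add0r scale1r; split=> //.
by rewrite scaleNr -addrA [- _ + _]addrC scalerBr.
Qed.

End Rigidity.

(** * Parameters for which the iteration converges unconditionally *)

Section Convergence.
Context (R : realType) (d : nat).
Notation V := 'rV[R]_d.

(** Along the iterates [phi] is a geometric sequence of ratio [l], which has no
    limit unless |l| < 1 or l = 1. *)
Lemma iterates_diverge (F : V -> V) (phi : V -> R) (l : R) (z0 zs : V) :
  continuous phi -> (forall z, phi (F z) = l * phi z) -> phi z0 != 0 ->
  1 <= `|l| -> l != 1 -> ~ (iter k F z0 @[k --> \oo] --> zs).
Proof.
move=> phi_cont phiF phi0 l1 l_neq1 lim.
have phi_lim : phi (iter k F z0) @[k --> \oo] --> phi zs.
  by apply: continuous_cvg lim; exact: phi_cont.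
have shift_lim : phi (iter k.+1 F z0) @[k --> \oo] --> phi zs.
  by move: phi_lim; rewrite -(cvg_shiftS (fun k => phi (iter k F z0))).
have fixed : phi zs = l * phi zs.
  apply: cvg_unique shift_lim _; first exact: norm_hausdorff.
  have -> : (fun k => phi (iter k.+1 F z0)) = (fun k => l * phi (iter k F z0)).
    by apply/funext => k; rewrite iterS phiF.
  by apply: cvgMr.
have phi_zs : phi zs = 0.
  apply/eqP; have /eqP : (1 - l) * phi zs = 0 by rewrite mulrBl mul1r -fixed subrr.
  by rewrite mulf_eq0 subr_eq0 [1 == l]eq_sym (negPf l_neq1).
have norm_ge k : `|phi z0| <= `|phi (iter k F z0)|.
  elim: k => //= k IH; rewrite phiF normrM (le_trans IH) //.
  by rewrite ler_peMl.
move: phi_lim; rewrite phi_zs => /cvgrPdist_lt /(_ `|phi z0|).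
rewrite normr_gt0 => /(_ phi0) [K _ /(_ K (leqnn K))] /=.
by rewrite sub0r normrN ltNge norm_ge.
Qed.

Context (i j : 'I_d) (ij : i != j).
Context (alpha beta : R) (alpha0 : 0 < alpha) (beta0 : 0 < beta).
Context (theta : R) (theta_neq0 : theta != 0) (T S : opmap R d).
Context (TE : forall (A B : maxmon R d) z,
  let a := resolvent alpha A z in
  T A B z = z + theta *:
    (resolvent beta B ((1 + beta / alpha) *: a - (beta / alpha) *: z) - a)).
Context (conv : converges_unconditionally T S).

(** With A = 0 and B the normal cone of the origin, [T] multiplies by 1 - theta. *)
Lemma relaxation_range : 0 < theta < 2.
Proof.
have zero : zer (add_op (cst_mm (0 : V)) (point_mm (0 : V))) !=set0.
  by exists 0, 0, 0; rewrite addr0.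
have [zs [lim _]] := conv zero (const_mx 1).
have T1 z : T (cst_mm 0) (point_mm 0) z = (1 - theta) *: z.
  rewrite TE /= resolvent_point // resolvent_cst // scaler0 subr0 sub0r.
  by rewrite scalerBl scale1r scalerN.
have l_lt1 : `|1 - theta| < 1.
  rewrite ltNge; apply/negP => l_ge1; apply: (iterates_diverge _ _ _ l_ge1 _ lim).
  - exact: (@coord_continuous _ _ _ 0 i).
  - by move=> z; rewrite T1 /= mxE.
  - by rewrite /= mxE oner_eq0.
  - by apply: contra theta_neq0 => /eqP h; apply/eqP; lra.
by move: l_lt1; rewrite ltr_norml => /andP[h1 h2]; apply/andP; split; lra.
Qed.

(** In the complex coordinate of a plane, resolvents of turns are points a, b
    of the circle with diameter [0, 1], and [T] multiplies by
    1 + theta (b w - a) with w = (1 + rho) a - rho and rho = beta / alpha. For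
    a = (1 + i) / 2 and rho <> 1 the circle has a point b for which
    Re (b w) > 1 / 2 = Re a: the choice b = 1 / (1 + i t) gives
    Re (b w - a) = (t - 1) (rho - t) / (2 (1 + t^2)), which is positive half-way
    between 1 and rho. Then [T] multiplies the norm by a factor above 1. *)
Lemma equal_stepsizes : alpha = beta.
Proof.
apply/eqP/negPn/negP => ab; have /andP[th0 _] := relaxation_range.
pose rho := beta / alpha; pose tau := (1 + rho) / 2.
have rho_neq1 : rho != 1.
  apply: contra ab => /eqP h; rewrite eq_sym; apply/eqP.
  by rewrite -[LHS](@divfK _ alpha) ?gt_eqF // -/rho h mul1r.
pose A := turn_mm ij (1 / alpha); pose B := turn_mm ij (- tau / beta).
have zero : zer (add_op A B) !=set0.
  exists 0, 0, 0; rewrite addr0.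
  by split; [|split]; rewrite //= /turn_op /= turn0 scaler0.
have [zs [lim _]] := conv zero (const_mx 1).
pose mr := 1 + theta * ((tau - 1) * (rho - tau) / (2 * (1 + tau ^+ 2))).
pose mi := theta * (((1 + rho) - tau * (1 - rho)) / (2 * (1 + tau ^+ 2)) - 1 / 2).
have tau0 : 1 + tau ^+ 2 != 0 by rewrite gt_eqF // ltr_pwDl // sqr_ge0.
have [Ti Tj] : (forall z, T A B z 0 i = mr * z 0 i - mi * z 0 j) /\
               (forall z, T A B z 0 j = mr * z 0 j + mi * z 0 i).
  split=> z; rewrite TE -/rho; have [ai aj] := resolvent_turn ij 1 z alpha0.
    set w := (1 + rho) *: _ - _; have [bi _] := resolvent_turn ij (- tau) w beta0.
    rewrite !mxE; move: bi ai aj; rewrite /w !mxE -/A -/B.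
    move=> -> -> ->; rewrite /mr /mi sqrrN expr1n; field.
    by rewrite tau0.
  set w := (1 + rho) *: _ - _; have [_ bj] := resolvent_turn ij (- tau) w beta0.
  rewrite !mxE; move: bj ai aj; rewrite /w !mxE -/A -/B.
  move=> -> -> ->; rewrite /mr /mi sqrrN expr1n; field.
  by rewrite tau0.
have mr1 : 1 < mr.
  rewrite /mr ltrDl mulr_gt0 // divr_gt0 //.
    have -> : (tau - 1) * (rho - tau) = ((rho - 1) / 2) ^+ 2 by rewrite /tau; field.
    by rewrite exprn_even_gt0 //= mulf_neq0 ?invr_eq0 // subr_eq0.
  by rewrite mulr_gt0 // ltr_pwDl // sqr_ge0.
have m1 : 1 < mr ^+ 2 + mi ^+ 2.
  have := sqr_ge0 mi; nra.
have coord k : continuous (fun z : V => z 0 k) by exact: coord_continuous.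
apply: (@iterates_diverge (T A B) (fun z => z 0 i * z 0 i + z 0 j * z 0 j)
   (mr ^+ 2 + mi ^+ 2) (const_mx 1) zs) lim.
- by move=> z; exact: cvgD (cvgM (coord i z) (coord i z)) (cvgM (coord j z) (coord j z)).
- by move=> z; rewrite Ti Tj; ring.
- by rewrite !mxE gt_eqF // addr_gt0 // exprn_gt0.
- by rewrite ger0_norm ltW // (lt_trans _ m1).
- by rewrite gt_eqF.
Qed.

End Convergence.

Lemma two_step_drs (R : realType) (d : nat) (hd : (2 <= d)%N)
    (P : opmap R d * opmap R d)
    (alpha beta c : R) pq t s :
  0 < alpha -> 0 < beta -> splitting P ->
  two_step_form alpha beta c pq t s P.1 P.2 ->
  exists Q : opmap R d * opmap R d,
    DRS_splitting Q.1 Q.2 /\ exists2 a : R, a != 0 & P = Defs.scale_pair a Q.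
Proof.
move=> al0 be0 spl form.
pose i0 : 'I_d := Ordinal (ltnW hd); pose i1 : 'I_d := Ordinal hd.
have i01 : i0 != i1 by [].
have [[enc _ _] _] := spl.
have [c0 [theta [eta [th0 PE]]]] := encoding_rigid i0 al0 be0 form enc.
have cK z : c *: (c^-1 *: z) = z :> 'rV[R]_d by rewrite scalerA divff // scale1r.
pose Q := Defs.scale_pair c P.
have QE (A B : maxmon R d) z : let a := resolvent alpha A z in
    let b := resolvent beta B ((1 + beta / alpha) *: a - (beta / alpha) *: z) in
    Q.1 A B z = z + (c * theta) *: (b - a) /\
    Q.2 A B z = eta *: a + (1 - eta) *: b.
  move=> a b; have [/= Q1 Q2] := PE A B (c^-1 *: z).
  by rewrite /Q /= Q1 Q2 !cK; split=> //; rewrite scalerDr cK scalerA.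
have [_ [_ Qconv]] := splitting_scale c0 spl.
have cth0 : c * theta != 0 by rewrite mulf_neq0.
have Q1E A B z := (QE A B z).1.
have /andP[cth_gt0 cth_lt2] := relaxation_range i0 al0 be0 cth0 Q1E Qconv.
have ab := equal_stepsizes i01 al0 be0 cth0 Q1E Qconv.
exists Q; split; last first.
  exists c^-1; first by rewrite invr_eq0.
  rewrite /Q /Defs.scale_pair /= invrK; case: (P) => T S /=.
  congr (_, _); do 3!apply/funext => ?; rewrite ?cK scalerA mulVf // scale1r //.
  by rewrite scalerA mulVf // scale1r.
exists alpha, (c * theta), eta; split=> // A B z.
have [-> ->] := QE A B z; rewrite -ab divff ?gt_eqF //.
have refl : (1 + 1) *: resolvent alpha A z - 1 *: z = reflected alpha A z.
  by rewrite scale1r.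
by rewrite refl -drs_mapE.
Qed.

Theorem corollary1 (R : realType) (d : nat) (hd : (2 <= d)%N)
    (T S : opmap R d) :
  (resolvent_splitting T S /\ frugal T S /\ converges_unconditionally T S) <->
  (exists That Shat : opmap R d,
     DRS_splitting That Shat /\ equivalent (T, S) (That, Shat)).
Proof.
split=> [spl|[That [Shat [[al [th [eta [al0 th0 th2 drs]]]] [a a0 eqv]]]]].
  have [al [be [c [pq [t [s [al0 be0 [form|form]]]]]]]] :=
    frugal_two_step_form spl.2.1.
  - have [[That Shat] [drs [a a0 eqv]]] :=
      two_step_drs (P := (T, S)) hd al0 be0 spl form.
    by exists That, Shat; split=> //; exists a => //; left.
  - have [[That Shat] [drs [a a0 [TE SE]]]] :=
      two_step_drs hd al0 be0 (splitting_swap (P := (T, S)) spl) form.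
    exists That, Shat; split=> //; exists a => //; right.
    rewrite /Defs.scale_pair /=; congr (_, _); apply/funext => A; apply/funext => B.
      exact: (congr1 (fun F => F B A) TE).
    exact: (congr1 (fun F => F B A) SE).
have drsE : (That, Shat) = (drs_map al th, drs_solution al eta).
  congr (_, _); apply/funext => A; apply/funext => B; apply/funext => z.
    exact: (drs A B z).1.
  exact: (drs A B z).2.
have spl : splitting (That, Shat) by rewrite drsE; exact: drs_splitting.
suff : splitting (T, S) by [].
by case: eqv => ->; apply: splitting_scale => //; exact: (splitting_swap spl).
Qed.
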